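(* Let $\mathcal{M}$ be a compact Riemannian manifold, let $Z$ be a 1-MSD Gaussian process on $\mathcal{M}$ with differentiable mean function $\mu$ and covariance function $K$, and let $V$ be a smooth vector field on $\mathcal{M}$. Then the derivative process $D_VZ$ is a valid Gaussian process on $\mathcal{M}$ with mean function $x\mapsto\langle\nabla\mu(x),V_x\rangle$ and covariance function $$K_V(x,x')=\operatorname{Cov}(D_VZ(x),D_VZ(x'))=(\nabla_{12}K(x,x'))(V_x,V_{x'}),\qquad x,x'\in\mathcal{M}.$$
   Context: $\langle\cdot,\cdot\rangle$ is the Riemannian metric, $\exp_x$ the Riemannian exponential map, $V_x=V(x)$. $Z$ is 1-MSD if for every $x\in\mathcal{M}$ and every geodesic $\gamma$ with $\gamma(0)=x$, $\lim_{t\to0}\mathbb{E}\big(\frac{Z(\gamma(t))-Z(x)}{t}\big)^2$ exists (finite). The derivative process is the mean-square limit $D_VZ(x)=\lim_{t\to0}\frac{Z(\exp_x(tV_x))-Z(x)}{t}$, which is taken to exist for 1-MSD $Z$. $\nabla_{12}$ denotes the partial gradient of $K$ (a function on $\mathcal{M}\times\mathcal{M}$) with respect to the first and second coordinates: $(\nabla_{12}K(x,x'))(V_x,V_{x'})$ is the mixed directional derivative $$\lim_{t,s\to0}\frac{1}{ts}\big[K(\exp_x(tV_x),\exp_{x'}(sV_{x'}))-K(x,\exp_{x'}(sV_{x'}))-K(\exp_x(tV_x),x')+K(x,x')\big].$$ *)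

(* Defs.v *)
From HB Require Import structures.
From mathcomp Require Import all_boot all_order all_algebra.
From mathcomp Require Import all_classical all_reals all_analysis.
Set Implicit Arguments.
Unset Strict Implicit.
Unset Printing Implicit Defensive.
Import Order.TTheory GRing.Theory Num.Theory.
Import numFieldNormedType.Exports.
Local Open Scope classical_set_scope.
Local Open Scope ring_scope.

(* For V of finite dimension and U open, [Ck k U f] is the usual C^k property
   of f on U; the values of f outside U are irrelevant. *)
Fixpoint Ck (R : realType) (V W : normedModType R) (k : nat) (U : set V)
    (f : V -> W) : Prop :=
  if k is k'.+1 then
    (forall x, U x -> differentiable f x) /\
    (forall v, Ck k' U (fun x => 'D_v f x))
  else forall x, U x -> {for x, continuous f}.

Definition smooth_on (R : realType) (V W : normedModType R) (U : set V)
    (f : V -> W) : Prop :=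
  forall k, Ck k U f.

(* An n-dimensional smooth manifold given by an atlas indexed by [chart].
   The chart i is the homeomorphism [chart_coord i] from [chart_dom i] to an
   open subset of R^n, with inverse [chart_param i]; both are totalized and
   their values outside [chart_dom i], respectively
   [chart_coord i @` chart_dom i], are irrelevant. *)
Record smoothManifold (R : realType) (n : nat) := SmoothManifold {
  mpoint :> topologicalType ;
  chart : Type ;
  chart_dom : chart -> set mpoint ;
  chart_coord : chart -> mpoint -> 'rV[R]_n ;
  chart_param : chart -> 'rV[R]_n -> mpoint ;
  mfd_hausdorff : hausdorff_space mpoint ;
  mfd_second_countable : @second_countable mpoint ;
  dom_cover : forall x, exists i, chart_dom i x ;
  dom_open : forall i, open (chart_dom i) ;
  img_open : forall i, open (chart_coord i @` chart_dom i) ;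
  coordK : forall i x, chart_dom i x -> chart_param i (chart_coord i x) = x ;
  coord_continuous : forall i x,
    chart_dom i x -> {for x, continuous (chart_coord i)} ;
  param_continuous : forall i y,
    (chart_coord i @` chart_dom i) y -> {for y, continuous (chart_param i)} ;
  transition_smooth : forall i j,
    smooth_on (chart_coord i @` (chart_dom i `&` chart_dom j))
      (chart_coord j \o chart_param i) }.

(* A tangent vector at x is the family of its coordinate vectors in all the
   charts around x, related by the differentials of the transition maps; it is
   set to 0 in the other charts so that Leibniz equality is equality of tangent
   vectors and the vector space operations are the pointwise ones. *)
Definition tvec (R : realType) (n : nat) (M : smoothManifold R n) : Type :=
  chart M -> 'rV[R]_n.

HB.instance Definition _ (R : realType) (n : nat) (M : smoothManifold R n) :=
  GRing.Lmodule.copy (tvec M) (chart M -> 'rV[R]_n).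
HB.instance Definition _ (R : realType) (n : nat) (M : smoothManifold R n) :=
  Pointed.copy (tvec M) (chart M -> 'rV[R]_n).

Section Manifold.
Variables (R : realType) (n : nat) (M : smoothManifold R n).
Local Notation tvec := (tvec M).

Definition tangent (x : M) : set tvec :=
  [set v | (forall i, ~ chart_dom i x -> v i = 0) /\
           (forall i j, chart_dom i x -> chart_dom j x ->
              v j = 'd (chart_coord j \o chart_param i) (chart_coord i x) (v i))].

(* The tangent vector at x with coordinates u in the chart i around x. *)
Definition tvec_of (i : chart M) (x : M) (u : 'rV[R]_n) : tvec :=
  fun j => if `[< chart_dom j x >]
           then 'd (chart_coord j \o chart_param i) (chart_coord i x) u else 0.

(* Gram matrix, at the point of coordinates y, of the coordinate vector fields
   of the chart i. *)
Definition gram (inner : M -> tvec -> tvec -> R) (i : chart M)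
    (y : 'rV[R]_n) : 'M[R]_n :=
  \matrix_(a < n, b < n)
    inner (chart_param i y) (tvec_of i (chart_param i y) (delta_mx 0 a))
                            (tvec_of i (chart_param i y) (delta_mx 0 b)).

Record riemannianMetric := RiemannianMetric {
  inner : M -> tvec -> tvec -> R ;
  inner_sym : forall x u v, tangent x u -> tangent x v ->
    inner x u v = inner x v u ;
  inner_linear : forall x (a : R) u v w,
    tangent x u -> tangent x v -> tangent x w ->
    inner x (a *: u + v) w = a * inner x u w + inner x v w ;
  inner_pos : forall x v, tangent x v -> v <> 0 -> 0 < inner x v v ;
  inner_smooth : forall i (a b : 'I_n),
    smooth_on (chart_coord i @` chart_dom i) (fun y => gram inner i y a b) }.

Definition smooth_vector_field (V : M -> tvec) : Prop :=
  (forall x, tangent x (V x)) /\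
  (forall i, smooth_on (chart_coord i @` chart_dom i)
     (fun y => V (chart_param i y) i)).

Definition mdifferentiable (f : M -> R) : Prop :=
  forall i x, chart_dom i x ->
    differentiable (f \o chart_param i) (chart_coord i x).

Definition velocity (c : R -> M) (t : R) : tvec :=
  fun i => if `[< chart_dom i (c t) >]
           then derive1 (chart_coord i \o c) t else 0.

Variable g : riemannianMetric.

(* The gradient is the tangent vector that represents the differential of f at
   x through the metric. *)
Definition gradient (f : M -> R) (x : M) : tvec :=
  get [set w | tangent x w /\ forall v, tangent x v -> forall i, chart_dom i x ->
         inner g x w v = 'd (f \o chart_param i) (chart_coord i x) (v i)].

Definition christoffel (i : chart M) (y : 'rV[R]_n) (k a b : 'I_n) : R :=
  let G := gram (inner g) i in
  2^-1 * \sum_(l < n) invmx (G y) k l *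
    ('D_(delta_mx 0 a) (fun z => G z b l) y
     + 'D_(delta_mx 0 b) (fun z => G z a l) y
     - 'D_(delta_mx 0 l) (fun z => G z a b) y).

Definition geodesic (J : set R) (c : R -> M) : Prop :=
  [/\ open J, is_interval J,
      forall t, J t -> {for t, continuous c} &
      forall t i, J t -> chart_dom i (c t) ->
        let u := chart_coord i \o c in
        [/\ derivable u t 1, derivable (derive1 u) t 1 &
            forall k : 'I_n, derive1 (derive1 u) t 0 k +
              \sum_(a < n) \sum_(b < n) christoffel i (u t) k a b *
                (derive1 u t 0 a * derive1 u t 0 b) = 0]].

(* This property characterizes the Riemannian exponential map of a complete
   manifold, by uniqueness of geodesics; compact manifolds are complete. *)
Definition is_exponential (e : M -> tvec -> M) : Prop :=
  forall x v, tangent x v ->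
    let c := fun t : R => e x (t *: v) in
    [/\ geodesic setT c, c 0 = x & velocity c 0 = v].

End Manifold.

Section MixedDerivative.
Variables (R : realType) (n : nat) (M : smoothManifold R n).
Local Notation tvec := (tvec M).
Variables (e : M -> tvec -> M) (K : M -> M -> R).

Definition mixed_quotient (x : M) (v : tvec) (y : M) (w : tvec)
    (ts : R * R) : R :=
  (ts.1 * ts.2)^-1 *
  (K (e x (ts.1 *: v)) (e y (ts.2 *: w)) - K x (e y (ts.2 *: w))
   - K (e x (ts.1 *: v)) y + K x y).

(* Limits as t and s jointly tend to 0, with t and s nonzero. *)
Definition mixed_derivable (x : M) (v : tvec) (y : M) (w : tvec) : Prop :=
  cvg (mixed_quotient x v y w ts @[ts --> filter_prod (0:R)^' (0:R)^']).

Definition mixed_derive (x : M) (v : tvec) (y : M) (w : tvec) : R :=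
  lim (mixed_quotient x v y w ts @[ts --> filter_prod (0:R)^' (0:R)^']).

End MixedDerivative.

Section Processes.
Variables (R : realType) (d : measure_display) (T : measurableType d).
Variable P : probability T R.

(* N(m, s^2); [normal_prob m 0] is not the Dirac mass at m. *)
Definition gaussian_law (m s : R) (A : set R) : \bar R :=
  if s == 0 then \d_m A else normal_prob m s A.

Definition gaussian_rv (X : T -> R) : Prop :=
  exists m s : R, forall A, measurable A ->
    P (X @^-1` A) = gaussian_law m s A.

(* The finite-dimensional distributions are multivariate normal, possibly
   degenerate: all linear combinations are univariate normal. *)
Record gaussian_process (I : Type) (Z : I -> {RV P >-> R})
    (mu : I -> R) (K : I -> I -> R) : Prop := GaussianProcess {
  gp_fdd : forall (k : nat) (x : 'I_k -> I) (a : 'I_k -> R),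
    gaussian_rv (fun w => \sum_(i < k) a i * Z (x i) w) ;
  gp_mean : forall x, 'E_P[Z x]%E = (mu x)%:E ;
  gp_cov : forall x y, covariance P (Z x) (Z y) = (K x y)%:E }.

Variables (n : nat) (M : smoothManifold R n).
Local Notation tvec := (tvec M).

Definition msd1 (g : riemannianMetric M) (Z : M -> {RV P >-> R}) : Prop :=
  forall (x : M) (J : set R) (c : R -> M),
    geodesic g J c -> J 0 -> c 0 = x ->
    exists l : R,
      'E_P[(fun w => ((Z (c t) w - Z x w) / t) ^+ 2)%R]%E @[t --> (0:R)^']
        --> l%:E.

Definition is_derivative_process (e : M -> tvec -> M) (V : M -> tvec)
    (Z DZ : M -> {RV P >-> R}) : Prop :=
  forall x,
    'E_P[(fun w => ((Z (e x (t *: V x)) w - Z x w) / t - DZ x w) ^+ 2)%R]%E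
      @[t --> (0:R)^'] --> 0%E.

End Processes.

(* Main.v *)
Require Import Defs.
From HB Require Import structures.
From mathcomp Require Import all_boot all_order all_algebra.
From mathcomp Require Import ring lra.
From mathcomp Require Import all_classical all_reals all_analysis.
From mathcomp Require Import measurable_realfun.
Set Implicit Arguments.
Unset Strict Implicit.
Unset Printing Implicit Defensive.
Import Order.TTheory GRing.Theory Num.Theory.
Import numFieldNormedType.Exports.
Local Open Scope classical_set_scope.
Local Open Scope ring_scope.

(** A mean-square limit of Gaussian variables is Gaussian: after
    standardization the approximants all have the same law, and a mean-square
    limit of variables with a common law has that law; rescaling then gives the
    law of the limit. Applied to linear combinations of the difference quotients
    of [Z] along the curves [t |-> exp_x (t V_x)], this makes the derivative
    process Gaussian. Its mean and covariance are the limits of those of the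
    quotients, by continuity of the inner product of L^2: the covariance of two
    quotients is exactly the mixed difference quotient of [K], and the mean of a
    quotient is the difference quotient of [mu], which the chain rule and the
    representation of the differential by the metric identify with
    [<grad mu, V>]. *)

(** * Probability laws on the line and affine images of normal laws *)

(* [measurableTypeR R] has the measurable sets of [R] but another display; it is
   the type on which the library defines [normal_prob]. *)
Lemma probability_itvNyc_unique (R : realType) (m1 m2 : probability (measurableTypeR R) R) :
  (forall x : R, m1 `]-oo, x]%classic = m2 `]-oo, x]%classic) ->
  forall A, measurable A -> m1 A = m2 A.
Proof.
move=> m12 A mA.
(* The open rays []x, +oo[] generate the Borel sets and are stable under intersection, and the rays
   [g k], of finite mass, exhaust the line. On each ray the two measures agree by passing to the
   complement. *)
pose g k : set R := `](- k%:R), +oo[%classic.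
apply: (@measure_unique _ R (measurableTypeR R) (@RGenOInfty.G R) g _ _ _ _ m1 m2) => //.
- exact: RGenOInfty.measurableE.
- move=> _ _ [x ->] [y ->]; exists (Num.max x y).
  by apply/seteqP; split=> z /=; rewrite !in_itv /= !andbT gt_max; [case=> -> ->|move/andP].
- by move=> k; exists (- k%:R).
- apply/seteqP; split=> // x _; exists (Num.bound `|x|) => //=.
  by rewrite /g /= in_itv /= andbT ltrNl (le_lt_trans (ler_norm _))// normrN archi_boundP.
- by move=> _ [x ->]; rewrite -setCitvl; transitivity (1 - m1 `]-oo, x]%classic)%E;
  [exact: probability_setC|rewrite m12; apply/esym/probability_setC].
- by move=> k; apply: le_lt_trans (probability_le1 m1 (measurable_itv _)) (ltry 1).
Qed.

(** It suffices to compare masses of half-lines. There the increasing substitution [x |-> a * x + b]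
    turns one density integral into the other. *)
Lemma normal_prob_affine (R : realType) (a b m s : R) (A : set R) :
  0 < a -> s != 0 -> measurable A ->
  normal_prob m s ((fun x => a * x + b) @^-1` A) =
  normal_prob (a * m + b) (a * s) A.
Proof.
move=> a0 s0.
have as0 : a * s != 0 by rewrite mulf_eq0 negb_or s0 gt_eqF.
pose f : R -> R := fun x => a * x + b.
have mf : measurable_fun [set: R] f.
  apply: measurable_funD; last exact: measurable_cst.
  by apply: measurable_funM; [exact: measurable_cst|exact: measurable_id].
have mf' : @measurable_fun _ _ (measurableTypeR R) (measurableTypeR R) [set: R] f := mf.
pose fm := @mfun_Sub _ _ (measurableTypeR R) (measurableTypeR R) f (mem_set mf').
have fmE : fm = f :> (R -> R) by [].
have df x : derivable f x 1 by [].
have f'E : derive1 f = cst a.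
  apply/funext => x; rewrite derive1E /f deriveD// deriveM// derive_cst derive_id.
  by rewrite derive_cst !scaler0 !addr0 scaler1.
suff H : forall y : R, distribution (normal_prob m s) fm `]-oo, y]%classic =
    normal_prob (a * m + b) (a * s) `]-oo, y]%classic.
  exact: (@probability_itvNyc_unique R (distribution (normal_prob m s) fm) _ H).
move=> y.
rewrite /distribution /pushforward fmE.
pose x0 := (y - b) / a.
have yE : y = f x0 by rewrite /f /x0 mulrC divfK ?gt_eqF// subrK.
have -> : f @^-1` `]-oo, y]%classic = `]-oo, x0]%classic.
  apply/seteqP; split=> z /=; rewrite !in_itv /= yE /f lerD2r ler_pM2l//.
rewrite yE /normal_prob (increasing_ge0_integration_by_substitutionNy (F := f)); first last.
- by move=> x _; exact: normal_pdf_ge0.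
- by apply: continuous_subspaceT; exact: continuous_normal_pdf.
- apply/cvgrNyPle => r; apply: filterS (nbhs_ninfty_le (num_real ((r - b) / a))) => x xr.
  by rewrite /f -lerBrDr mulrC -ler_pdivlMr.
- split; first by move=> x _; exact: df.
  apply/cvg_at_left_filter/differentiable_continuous/derivable1_diffP; exact: df.
- rewrite f'E; exact: cvg_cst.
- rewrite f'E; exact: is_cvg_cst.
- by move=> x _; rewrite f'E; exact: cst_continuous.
- by move=> x z _ _ xz; rewrite /f ltrD2r ltr_pM2l.
(* The exponential factors coincide at corresponding points, and the Jacobian [a] is absorbed by the
   peak: [normal_peak s = a * normal_peak (a * s)]. *)
apply: eq_integral => x _; congr EFin; rewrite f'E /= !normal_pdfE// fctE /=.
have -> : normal_fun (a * m + b) (a * s) (f x) = normal_fun m s x.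
  congr expR; have -> : (f x - (a * m + b)) ^+ 2 = a ^+ 2 * (x - m) ^+ 2 by rewrite /f; ring.
  rewrite exprMn -mulrnAr -mulrN -mulf_div divff ?mul1r//.
  by rewrite expf_eq0 gt_eqF.
have -> : normal_peak s = a * normal_peak (a * s).
  rewrite /normal_peak.
  have -> : (a * s) ^+ 2 * pi *+ 2 = a ^+ 2 * (s ^+ 2 * pi *+ 2) by ring.
  rewrite sqrtrM ?sqr_ge0// sqrtr_sqr gtr0_norm//.
  by rewrite invfM mulrA divff ?mul1r// gt_eqF.
by rewrite -mulrA mulrC.
Qed.

(** * Square-integrable variables and the inner product of L^2 *)

Section square_integrable.
Context {R : realType} {d : measure_display} {T : measurableType d}.
Variable P : probability T R.
Implicit Types X Y : T -> R.

Local Notation L1 X := (X \in Lfun P 1).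
Local Notation L2 X := (X \in Lfun P 2%:E).

(** [fine] sends an infinite expectation to 0, so the linearity rules for [mean] and [ip] carry
    integrability hypotheses. [ip] is the L^2 inner product on functions rather than on classes,
    hence only semidefinite. *)
Definition mean X : R := fine 'E_P[X]%E.
Definition ip X Y : R := mean (fun w => X w * Y w).

Lemma sqintP X : L2 X <-> measurable_fun setT X /\ ('E_P[(fun w => X w ^+ 2)%R] < +oo)%E.
Proof.
split=> [L2X|[mX X2]].
  split; first by move: L2X; rewrite inE => /andP[+ _]; rewrite inE.
  rewrite unlock; exact: integrable_lty (Lfun2_integrable_sqr L2X).
rewrite inE; apply/andP; split; rewrite inE//= /finite_norm unlock poweR_lty//.
move: X2; rewrite unlock; congr (_ < _)%E; apply: eq_integral => w _ /=.
by rewrite powR_mulrn// real_normK// num_real.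
Qed.

Lemma sqint_int X : L2 X -> L1 X.
Proof. by apply: Lfun_subset12; exact: fin_num_measure. Qed.

Lemma intM X Y : L2 X -> L2 Y -> L1 (fun w => X w * Y w).
Proof. exact: Lfun2_mul_Lfun1. Qed.

Lemma sqint_cst k : L2 (fun _ : T => k).
Proof. exact: Lfun_cst. Qed.

Lemma sqintD X Y : L2 X -> L2 Y -> L2 (fun w => X w + Y w).
Proof. by move=> X2 Y2; apply: (rpredD X2 Y2); rewrite lee1n. Qed.

Lemma sqintZ k X : L2 X -> L2 (fun w => k * X w).
Proof.
move=> X2; rewrite (_ : (fun w => k * X w) = k \o* X); last by apply/funext => w /=; rewrite mulrC.
by apply: Lfun_scale => //; rewrite ler1n.
Qed.

Lemma sqintB X Y : L2 X -> L2 Y -> L2 (fun w => X w - Y w).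
Proof.
move=> X2 Y2; rewrite (_ : (fun _ => _) = fun w => X w + (-1) * Y w).
  by apply: sqintD => //; exact: sqintZ.
by apply/funext => w; rewrite mulN1r.
Qed.

Lemma mean_finK X : L1 X -> (mean X)%:E = 'E_P[X]%E.
Proof. by move=> X1; rewrite fineK// expectation_fin_num. Qed.

Lemma mean_cst k : mean (fun=> k) = k.
Proof. by rewrite /mean (expectation_cst P k). Qed.

Lemma meanD X Y : L1 X -> L1 Y -> mean (fun w => X w + Y w) = mean X + mean Y.
Proof.
move=> X1 Y1; rewrite /mean (expectationD X1 Y1) fineD//; exact: expectation_fin_num.
Qed.

Lemma meanZ k X : L1 X -> mean (fun w => k * X w) = k * mean X.
Proof.
move=> X1; rewrite (_ : (fun w => k * X w) = k \o* X); last by apply/funext => w /=; rewrite mulrC.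
by rewrite /mean (expectationZl k X1) fineM// expectation_fin_num.
Qed.

Lemma mean_ge0 X : (forall w, 0 <= X w) -> 0 <= mean X.
Proof. by move=> X0; apply: fine_ge0; exact: expectation_ge0. Qed.

Lemma ipC X Y : ip X Y = ip Y X.
Proof. by congr mean; apply/funext => w; rewrite mulrC. Qed.

Lemma ipDl X Y W : L2 X -> L2 Y -> L2 W -> ip (fun w => X w + Y w) W = ip X W + ip Y W.
Proof.
move=> X2 Y2 W2; rewrite -meanD; [|exact: intM|exact: intM].
by congr mean; apply/funext => w; rewrite mulrDl.
Qed.

Lemma ipZl k X W : L2 X -> L2 W -> ip (fun w => k * X w) W = k * ip X W.
Proof.
move=> X2 W2; rewrite -meanZ; last exact: intM.
by congr mean; apply/funext => w; rewrite mulrA.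
Qed.

Lemma ipBl X Y W : L2 X -> L2 Y -> L2 W -> ip (fun w => X w - Y w) W = ip X W - ip Y W.
Proof.
move=> X2 Y2 W2; rewrite -[- ip Y W]mulN1r -ipZl// -ipDl//; last exact: sqintZ.
by congr mean; apply/funext => w; rewrite mulN1r.
Qed.

Lemma ipDr X Y W : L2 X -> L2 Y -> L2 W -> ip W (fun w => X w + Y w) = ip W X + ip W Y.
Proof. by move=> X2 Y2 W2; rewrite !(ipC W) ipDl. Qed.

Lemma ipZr k X W : L2 X -> L2 W -> ip W (fun w => k * X w) = k * ip W X.
Proof. by move=> X2 W2; rewrite !(ipC W) ipZl. Qed.

Lemma ipBr X Y W : L2 X -> L2 Y -> L2 W -> ip W (fun w => X w - Y w) = ip W X - ip W Y.
Proof. by move=> X2 Y2 W2; rewrite !(ipC W) ipBl. Qed.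

Lemma ip1r X : ip X (fun=> 1) = mean X.
Proof. by congr mean; apply/funext => w; rewrite mulr1. Qed.

Lemma ip_ge0 X : 0 <= ip X X.
Proof. by apply: mean_ge0 => w; rewrite -expr2 sqr_ge0. Qed.

Lemma ip_cauchy_schwarz X Y : L2 X -> L2 Y ->
  `|ip X Y| <= Num.sqrt (ip X X) * Num.sqrt (ip Y Y).
Proof.
move=> X2 Y2; rewrite -sqrtrM ?ip_ge0// -sqrtr_sqr ler_wsqrtr//.
(* The discriminant argument: [q t] is the nonnegativity of the squared norm of [X + t Y]. *)
have q t : 0 <= ip X X + 2 * t * ip X Y + t ^+ 2 * ip Y Y.
  have := ip_ge0 (fun w => X w + t * Y w).
  rewrite ipDl ?ipDr ?ipZl ?ipZr ?sqintD ?sqintZ// (ipC Y X).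
  by congr (0 <= _); ring.
have [Y0|Y0] := eqVneq (ip Y Y) 0; last first.
  have Yp : 0 < ip Y Y by rewrite lt_def Y0 ip_ge0.
  (* The minimizer of the quadratic. *)
  have := q (- ip X Y / ip Y Y).
  rewrite -(pmulr_lge0 _ Yp) => h; rewrite -subr_ge0; move: h.
  by congr (0 <= _); field.
rewrite Y0 mulr0; have [->|XY0] := eqVneq (ip X Y) 0; first by rewrite expr0n.
(* When [ip Y Y = 0] the polynomial is affine in [t]; this [t] would give it the value -1. *)
have := q (- (ip X X + 1) / (2 * ip X Y)); rewrite Y0 mulr0 addr0.
suff -> : ip X X + 2 * (- (ip X X + 1) / (2 * ip X Y)) * ip X Y = -1 by rewrite oppr_ge0 ler10.
by field.
Qed.

(** The two families run along separate filters because the mixed derivative of [K] is a joint limit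
    in two independent parameters. *)
Lemma cvg_ip {I J : Type} (F : set_system I) (G : set_system J) {FF : Filter F} {FG : Filter G}
    (Xs : I -> T -> R) X (Ys : J -> T -> R) Y :
  (forall i, L2 (Xs i)) -> L2 X -> (forall j, L2 (Ys j)) -> L2 Y ->
  ip (fun w => Xs i w - X w) (fun w => Xs i w - X w) @[i --> F] --> 0 ->
  ip (fun w => Ys j w - Y w) (fun w => Ys j w - Y w) @[j --> G] --> 0 ->
  ip (Xs ij.1) (Ys ij.2) @[ij --> filter_prod F G] --> ip X Y.
Proof.
move=> Xs2 X2 Ys2 Y2 cX cY.
pose nX ij := Num.sqrt (ip (fun w => Xs (ij : I * J).1 w - X w) (fun w => Xs ij.1 w - X w)).
pose nY ij := Num.sqrt (ip (fun w => Ys (ij : I * J).2 w - Y w) (fun w => Ys ij.2 w - Y w)).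
have cnX : nX ij @[ij --> filter_prod F G] --> 0.
  have h : (fun ij : I * J => ip (fun w => Xs ij.1 w - X w) (fun w => Xs ij.1 w - X w))
      @ filter_prod F G --> 0.
    exact: (cvg_comp fst (fun i => ip (fun w => Xs i w - X w) (fun w => Xs i w - X w)) cvg_fst cX).
  have hh := continuous_cvg _ (@sqrt_continuous R 0) h; rewrite sqrtr0 in hh; exact: hh.
have cnY : nY ij @[ij --> filter_prod F G] --> 0.
  have h : (fun ij : I * J => ip (fun w => Ys ij.2 w - Y w) (fun w => Ys ij.2 w - Y w))
      @ filter_prod F G --> 0.
    exact: (cvg_comp snd (fun j => ip (fun w => Ys j w - Y w) (fun w => Ys j w - Y w)) cvg_snd cY).
  have hh := continuous_cvg _ (@sqrt_continuous R 0) h; rewrite sqrtr0 in hh; exact: hh.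
apply/subr_cvg0; apply: norm_cvg0.
(* With [A = Xs i - X] and [B = Ys j - Y], the error is [ip A B + ip A Y + ip X B]; Cauchy-Schwarz
   bounds each term by a product of norms in which the norm of [A] or of [B] occurs. *)
apply: (@squeeze_cvgr _ _ _ _ (fun=> 0)
  (fun ij => nX ij * nY ij + nX ij * Num.sqrt (ip Y Y) + Num.sqrt (ip X X) * nY ij)).
- apply: nearW => -[i j] /=; rewrite normr_ge0 /=.
  have -> : ip (Xs i) (Ys j) - ip X Y = ip (fun w => Xs i w - X w) (fun w => Ys j w - Y w)
      + ip (fun w => Xs i w - X w) Y + ip X (fun w => Ys j w - Y w).
    by rewrite !ipBl ?ipBr ?sqintB//; ring.
  rewrite (le_trans (ler_normD _ _))// lerD ?ip_cauchy_schwarz ?sqintB//.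
  by rewrite (le_trans (ler_normD _ _))// lerD ?ip_cauchy_schwarz ?sqintB.
- exact: cvg_cst.
- rewrite [X in _ --> X](_ : _ = 0 * 0 + 0 * Num.sqrt (ip Y Y) + Num.sqrt (ip X X) * 0); last by ring.
  by apply: cvgD; [apply: cvgD|]; apply: cvgM => //; exact: cvg_cst.
Qed.

End square_integrable.

(** * Equality in law and its stability under mean-square limits *)

Section laws.
Context {R : realType} {d : measure_display} {T : measurableType d}.
Variable P : probability T R.
Implicit Types X Y : T -> R.

Local Notation L1 X := (X \in Lfun P 1).
Local Notation L2 X := (X \in Lfun P 2%:E).

Definition same_law X Y :=
  forall A : set R, measurable A -> P (X @^-1` A) = P (Y @^-1` A).

Lemma same_law_comp (f : R -> R) X Y : measurable_fun setT f ->
  same_law X Y -> same_law (f \o X) (f \o Y).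
Proof.
move=> mf XY A mA; apply: (XY (f @^-1` A)).
by rewrite -[_ @^-1` _]setTI; exact: mf.
Qed.

(** Both means are integrals of the identity against the common distribution. *)
Lemma same_law_mean X Y : L1 X -> L1 Y -> same_law X Y -> mean P X = mean P Y.
Proof.
move=> X1 Y1 XY.
have mX : measurable_fun setT X by move: X1; rewrite inE => /andP[+ _]; rewrite inE.
have mY : measurable_fun setT Y by move: Y1; rewrite inE => /andP[+ _]; rewrite inE.
pose X' : {RV P >-> R} := mfun_Sub (mem_set mX).
pose Y' : {RV P >-> R} := mfun_Sub (mem_set mY).
rewrite /mean unlock; congr fine.
transitivity (\int[distribution P X']_y (y%:E))%E.
  rewrite integral_distribution//; exact/Lfun1_integrable.
transitivity (\int[distribution P Y']_y (y%:E))%E.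
  by apply: eq_measure_integral => A mA _; exact: XY.
rewrite integral_distribution//; exact/Lfun1_integrable.
Qed.

(* [X <= r] implies [Y <= r + e] or [e <= |X - Y|]; the second event is bounded
   by Chebyshev's inequality. *)
Lemma le_cdf_shift X Y (r e : R) : L2 X -> L2 Y -> 0 < e ->
  (P (X @^-1` `]-oo, r]%classic) <= P (Y @^-1` `]-oo, (r + e)%R]%classic)
     + (e ^- 2 * ip P (fun w => X w - Y w)%R (fun w => X w - Y w)%R)%:E)%E.
Proof.
move=> X2 Y2 e0.
have XY2 := sqintB X2 Y2.
have mX := (sqintP P X).1 X2; have mY := (sqintP P Y).1 Y2.
have mXY := (sqintP P _).1 XY2.
pose D : {RV P >-> R} := mfun_Sub (mem_set mXY.1).
have mE : measurable [set w | (e%:E <= `|(X w - Y w)%:E|)%E].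
  have -> : [set w | (e%:E <= `|(X w - Y w)%:E|)%E] = ((@Num.norm R R) \o D) @^-1` `[e, +oo[%classic.
    by apply/seteqP; split=> w /=; rewrite in_itv /= andbT lee_fin.
  rewrite -[_ @^-1` _]setTI.
  by apply: (measurableT_comp (@normr_measurable R setT) mXY.1).
have cheb : (P [set w | e%:E <= `|(X w - Y w)%:E|] <=
    (e ^- 2 * ip P (fun w => X w - Y w)%R (fun w => X w - Y w)%R)%:E)%E.
  rewrite EFinM lee_pdivlMl ?exprn_gt0//.
  have := @markov _ _ _ P D (fun x => x ^+ 2) e e0 _ _ _.
  rewrite /ip mean_finK; last exact: intM.
  rewrite (_ : (fun x => x ^+ 2) \o (fun x => `|x|%R) \o D = fun w => (X w - Y w) * (X w - Y w)); last first.
    by apply/funext => w /=; rewrite real_normK ?num_real// expr2.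
  apply.
  - exact: measurable_funX.
  - by move=> x _; exact: sqr_ge0.
  - by move=> x y; rewrite !nnegrE => x0 y0 xy; rewrite ler_sqr.
apply: le_trans (leeD2l _ cheb).
apply: le_trans (measureU2 _ _ _); last 2 first.
- by rewrite -[_ @^-1` _]setTI; exact: mY.1.
- exact: mE.
apply: le_measure.
- by rewrite inE -[_ @^-1` _]setTI; exact: mX.1.
- by rewrite inE; apply: measurableU => //; rewrite -[_ @^-1` _]setTI; exact: mY.1.
move=> w /=; rewrite !in_itv /= => Xr.
have [Yr|Yr] := leP (Y w) (r + e); first by left.
by right; rewrite lee_fin distrC ger0_norm; lra.
Qed.


Lemma same_law_cdf X Y : measurable_fun setT X -> measurable_fun setT Y ->
  (forall r : R, P (X @^-1` `]-oo, r]%classic) = P (Y @^-1` `]-oo, r]%classic)) ->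
  same_law X Y.
Proof.
move=> mX mY XY A mA.
have mX' : @measurable_fun _ _ T (measurableTypeR R) setT X := mX.
have mY' : @measurable_fun _ _ T (measurableTypeR R) setT Y := mY.
exact: (@probability_itvNyc_unique R
  (distribution P (@mfun_Sub _ _ T (measurableTypeR R) X (mem_set mX')))
  (distribution P (@mfun_Sub _ _ T (measurableTypeR R) Y (mem_set mY'))) XY A mA).
Qed.

(** Right-continuity of the distribution function of [Y] lets [e] decrease to 0. *)
Lemma le_cdf_right X Y (r : R) : measurable_fun setT Y ->
  (forall e : R, 0 < e -> (P (X @^-1` `]-oo, r]%classic) <= P (Y @^-1` `]-oo, (r + e)%R]%classic))%E) ->
  (P (X @^-1` `]-oo, r]%classic) <= P (Y @^-1` `]-oo, r]%classic))%E.
Proof.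
move=> mY XY; pose Y' : {RV P >-> R} := mfun_Sub (mem_set mY).
suff : (P (X @^-1` `]-oo, r]%classic) <= cdf Y' r)%E by [].
apply: (cvge_ge _ (@cdf_right_continuous _ _ _ P Y' r)).
near=> x; have := XY (x - r); rewrite subr_gt0 subrKC; apply.
by near: x; exact: nbhs_right_gt.
Unshelve. all: by end_near. Qed.

(** [le_cdf_shift] is used in both directions between [X] and [Xs i]. For fixed [e] the Chebyshev
    term vanishes along [F]; then [le_cdf_right] removes the shift [e]. *)
Lemma same_law_limit {I : Type} (F : set_system I) {FF : ProperFilter F}
    (Xs : I -> T -> R) X Y :
  (forall i, L2 (Xs i)) -> L2 X -> measurable_fun setT Y ->
  ip P (fun w => Xs i w - X w) (fun w => Xs i w - X w) @[i --> F] --> 0 ->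
  (\forall i \near F, same_law (Xs i) Y) -> same_law X Y.
Proof.
move=> Xs2 X2 mY cX lX.
have mX := ((sqintP P X).1 X2).1.
have lim0 (a b : \bar R) (e : R) : 0 < e ->
    (\forall i \near F, (a <= b + (e ^- 2 * ip P (fun w => Xs i w - X w) (fun w => Xs i w - X w))%:E)%E) ->
    (a <= b)%E.
  move=> e0 ab; apply/lee_addgt0Pr => r r0.
  have : \forall i \near F, ip P (fun w => Xs i w - X w) (fun w => Xs i w - X w) < e ^+ 2 * r.
    by apply: (cvgr_lt _ cX); rewrite mulr_gt0// exprn_gt0.
  move=> /(filterI ab) /filter_ex[i [abi iri]].
  apply: (le_trans abi); rewrite leeD2l// lee_fin ler_pdivrMl ?exprn_gt0//; exact: ltW.
have sym i : ip P (fun w => X w - Xs i w) (fun w => X w - Xs i w) =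
    ip P (fun w => Xs i w - X w) (fun w => Xs i w - X w).
  by congr mean; apply/funext => w; ring.
apply: same_law_cdf => // r; apply/eqP; rewrite eq_le; apply/andP; split.
  apply: le_cdf_right => // e e0; apply: (lim0 _ _ e) => //.
  apply: filterS lX => i XiY; rewrite -XiY//.
  by rewrite -sym; exact: le_cdf_shift.
apply: le_cdf_right => // e e0; apply: (lim0 _ _ e) => //.
apply: filterS lX => i XiY; rewrite -XiY//.
exact: le_cdf_shift.
Qed.

End laws.

(** * Gaussian laws, standardization and Gaussian limits *)

Section gaussian.
Context {R : realType} {d : measure_display} {T : measurableType d}.
Variable P : probability T R.
Implicit Types X Y : T -> R.

Local Notation L2 X := (X \in Lfun P 2%:E).

Definition has_gaussian_law X (m s : R) :=
  forall A : set R, measurable A -> P (X @^-1` A) = gaussian_law m s A.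

(** [gaussian_rv] puts no sign condition on [s]; this permits a nonnegative choice. *)
Lemma gaussian_law_norm (m s : R) (A : set R) : gaussian_law m `|s| A = gaussian_law m s A.
Proof.
rewrite /gaussian_law normr_eq0; case: eqP => // _; rewrite /normal_prob.
apply: eq_integral => x _; congr EFin.
by rewrite /normal_pdf normr_eq0 /normal_peak /normal_fun real_normK ?num_real.
Qed.

Lemma has_gaussian_law_affine X (m s a b : R) : 0 < a ->
  has_gaussian_law X m s -> has_gaussian_law (fun w => a * X w + b) (a * m + b) (a * s).
Proof.
move=> a0 Xms A mA.
have mf : measurable_fun [set: R] (fun x : R => a * x + b).
  apply: measurable_funD; last exact: measurable_cst.
  by apply: measurable_funM; [exact: measurable_cst|exact: measurable_id].
have -> : (fun w => a * X w + b) @^-1` A = X @^-1` ((fun x => a * x + b) @^-1` A) by [].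
rewrite Xms; last by rewrite -[_ @^-1` _]setTI; exact: mf.
rewrite /gaussian_law mulf_eq0 (gt_eqF a0) orFb; case: (eqVneq s 0) => s0.
  suff E : (m \in (fun x => a * x + b) @^-1` A) = (a * m + b \in A).
    by rewrite !diracE; apply: congr1; apply: (congr1 (fun c : bool => c%:R)); exact: E.
  by apply/idP/idP; rewrite !inE.
exact: normal_prob_affine.
Qed.

Lemma has_gaussian_law_cst (m : R) : has_gaussian_law (fun=> m) m 0.
Proof.
move=> A mA; rewrite /gaussian_law eqxx diracE.
have [mA'|mA'] := boolP (m \in A).
  rewrite (_ : _ @^-1` A = setT) ?probability_setT//.
  by apply/seteqP; split=> // w _; exact: set_mem.
rewrite (_ : _ @^-1` A = set0) ?measure0//.
by apply/seteqP; split=> // w Am; case/negP: mA'; exact: mem_set.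
Qed.

(* The mean and variance of the normal law are not needed: if [a * Y + b] has the
   law of [X], comparing the first two moments gives [b = 0] and [a = 1]. *)
Lemma standard_gaussian_same_law X Y : L2 X -> L2 Y ->
  gaussian_rv P X -> gaussian_rv P Y ->
  mean P X = 0 -> mean P Y = 0 -> ip P X X = 1 -> ip P Y Y = 1 ->
  same_law P X Y.
Proof.
(* If [s = 0], then [U] has the law of the constant [m]; the first moment gives [m = 0], and the
   second moment would then be 0 instead of 1. *)
have nondeg U m s : L2 U -> has_gaussian_law U m s -> mean P U = 0 -> ip P U U = 1 -> 0 < `|s|.
  move=> U2 Ums U0 U1; rewrite normr_gt0; apply/eqP => s0; subst s.
  have Um : same_law P U (fun=> m).
    by move=> A mA; rewrite Ums// has_gaussian_law_cst.
  have := same_law_mean (sqint_int U2) (sqint_int (sqint_cst _ m)) Um.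
  rewrite U0 mean_cst => m0; subst m.
  have sq : measurable_fun [set: R] (fun x : R => x * x) by exact: measurable_funM.
  have := same_law_mean (intM U2 U2) (sqint_int (sqint_cst _ _)) (same_law_comp sq Um).
  by rewrite -/(ip P U U) U1 mean_cst mulr0 => /eqP; rewrite oner_eq0.
move=> X2 Y2 [m [s Xms]] [m' [s' Yms]] X0 Y0 X1 Y1.
have s0 := nondeg _ _ _ X2 Xms X0 X1; have s0' := nondeg _ _ _ Y2 Yms Y0 Y1.
(* [a] and [b] are chosen so that [a * m' + b = m] and [a * |s'| = |s|]. *)
pose a := `|s| / `|s'|.
have a0 : 0 < a by rewrite divr_gt0.
pose b := m - a * m'.
have XY : same_law P X (fun w => a * Y w + b).
  move=> A mA; have Yms' : has_gaussian_law Y m' `|s'|.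
    by move=> B mB; rewrite gaussian_law_norm; exact: Yms.
  rewrite (has_gaussian_law_affine b a0 Yms')// Xms// -gaussian_law_norm.
  by rewrite /b /a subrKC divfK// gt_eqF.
have b0 : b = 0.
  have := same_law_mean (sqint_int X2) (sqint_int (sqintD (sqintZ a Y2) (sqint_cst P b))) XY.
  rewrite meanD ?meanZ ?mean_cst ?sqint_int ?sqintZ ?sqint_cst//.
  by rewrite X0 Y0 mulr0 add0r => /esym.
have a1 : a = 1.
  have aY2 := sqintD (sqintZ a Y2) (sqint_cst P b).
  have sq : measurable_fun [set: R] (fun x : R => x * x) by exact: measurable_funM.
  have := same_law_mean (intM X2 X2) (intM aY2 aY2) (same_law_comp sq XY).
  rewrite -/(ip P X X) X1 b0.
  rewrite (_ : (fun w => _) = fun w => a ^+ 2 * (Y w * Y w)); last by apply/funext => w; ring.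
  rewrite meanZ ?intM// -/(ip P Y Y) Y1 mulr1 => /esym/eqP.
  by rewrite sqrf_eq1 => /orP[/eqP//|/eqP aN1]; move: a0; rewrite aN1; lra.
move=> A mA; rewrite XY// b0 a1; congr (P (_ @^-1` A)).
by apply/funext => w; rewrite mul1r addr0.
Qed.

(** The degenerate case of the limit theorem: the constant sequence [m] converges to [X] in mean
    square, so [X] has the law of that constant. *)
Lemma gaussian_rv_ae_cst X (m : R) : L2 X -> ip P (fun w => X w - m) (fun w => X w - m) = 0 ->
  gaussian_rv P X.
Proof.
move=> X2 X0; exists m, 0; rewrite -/(has_gaussian_law X m 0).
suff Xm : same_law P X (fun=> m).
  by move=> A mA; rewrite Xm// has_gaussian_law_cst.
apply: (@same_law_limit R _ T P nat \oo _ (fun _ _ => m)) => //.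
- by move=> _; exact: sqint_cst.
- rewrite (_ : (fun _ => _) = fun=> 0); first exact: cvg_cst.
  apply/funext => _; rewrite -X0; congr mean; apply/funext => w; ring.
- by apply: nearW => _ A.
Qed.

Lemma cvg_ip_diag {I : Type} (F : set_system I) {FF : Filter F}
    (Xs : I -> T -> R) X (Ys : I -> T -> R) Y :
  (forall i, L2 (Xs i)) -> L2 X -> (forall i, L2 (Ys i)) -> L2 Y ->
  ip P (fun w => Xs i w - X w) (fun w => Xs i w - X w) @[i --> F] --> 0 ->
  ip P (fun w => Ys i w - Y w) (fun w => Ys i w - Y w) @[i --> F] --> 0 ->
  ip P (Xs i) (Ys i) @[i --> F] --> ip P X Y.
Proof.
move=> Xs2 X2 Ys2 Y2 cX cY.
have diag : (fun i : I => (i, i)) @ F `=>` filter_prod F F by exact: cvg_pair.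
exact: (cvg_comp _ (fun ij : I * I => ip P (Xs ij.1) (Ys ij.2)) diag (cvg_ip Xs2 X2 Ys2 Y2 cX cY)).
Qed.

Lemma ip_subrr {I : Type} (F : set_system I) {FF : Filter F} X :
  ip P (fun w => X w - X w) (fun w => X w - X w) @[_ --> F] --> 0.
Proof.
rewrite (_ : ip P _ _ = 0); first exact: cvg_cst.
rewrite -[RHS](mean_cst P 0); congr mean; apply/funext => w; ring.
Qed.

Definition var X : R := ip P X X - mean P X ^+ 2.

(* For [var X = 0] this is the zero function, as [0^-1 = 0]. *)
Definition standardize X : T -> R :=
  fun w => (Num.sqrt (var X))^-1 * X w + - ((Num.sqrt (var X))^-1 * mean P X).

Lemma sqint_standardize X : L2 X -> L2 (standardize X).
Proof. by move=> X2; apply: sqintD; [exact: sqintZ|exact: sqint_cst]. Qed.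

Lemma mean_standardize X : L2 X -> mean P (standardize X) = 0.
Proof.
move=> X2; rewrite meanD ?meanZ ?mean_cst ?sqint_int ?sqintZ ?sqint_cst//.
by rewrite subrr.
Qed.

Lemma ip_cstr X (k : R) : L2 X -> ip P X (fun=> k) = k * mean P X.
Proof.
by move=> X2; rewrite -meanZ ?sqint_int//; congr mean; apply/funext => w; rewrite mulrC.
Qed.

Lemma ip_sub X Y : L2 X -> L2 Y ->
  ip P (fun w => X w - Y w) (fun w => X w - Y w) = ip P X X - 2 * ip P X Y + ip P Y Y.
Proof. by move=> X2 Y2; rewrite ipBl ?ipBr ?sqintB// (ipC P Y X); ring. Qed.

Lemma ip_cstl X (k : R) : L2 X -> ip P (fun=> k) X = k * mean P X.
Proof. by move=> X2; rewrite ipC ip_cstr. Qed.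

Lemma ip_standardize X Y : L2 X -> L2 Y -> ip P (standardize X) (standardize Y) =
  (Num.sqrt (var X))^-1 * (Num.sqrt (var Y))^-1 * (ip P X Y - mean P X * mean P Y).
Proof.
move=> X2 Y2; rewrite ipDr ?sqintZ ?sqint_cst ?sqint_standardize//.
rewrite (ip_cstr _ (sqint_standardize X2)) mean_standardize// mulr0 addr0.
rewrite ipZr ?sqint_standardize// ipDl ?sqintZ ?sqint_cst// ipZl//.
by rewrite (ip_cstl _ Y2); ring.
Qed.

Lemma ip_standardize1 X : L2 X -> 0 < var X -> ip P (standardize X) (standardize X) = 1.
Proof.
move=> X2 v0; rewrite ip_standardize// -invfM -!expr2 -/(var X) sqr_sqrtr ?(ltW v0)//.
by rewrite mulVf// gt_eqF.
Qed.

Lemma varE X : L2 X -> var X = ip P (fun w => X w - mean P X) (fun w => X w - mean P X).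
Proof.
move=> X2; have m2 := sqint_cst P (mean P X).
rewrite ipBl ?ipBr ?sqintB// (ip_cstl _ X2) (ip_cstr _ X2) (ip_cstr _ m2).
rewrite mean_cst /var; ring.
Qed.

Lemma var_ge0 X : L2 X -> 0 <= var X.
Proof. by move=> X2; rewrite varE// ip_ge0. Qed.

Lemma gaussian_rv_standardize X : 0 < var X -> gaussian_rv P X ->
  gaussian_rv P (standardize X).
Proof.
move=> v0 [m [s Xms]]; eexists; eexists; apply: has_gaussian_law_affine Xms.
by rewrite invr_gt0 sqrtr_gt0.
Qed.

Lemma gaussian_rv_unstandardize X : 0 < var X -> gaussian_rv P (standardize X) ->
  gaussian_rv P X.
Proof.
move=> v0 [m [s Sms]].
have v0' : 0 < Num.sqrt (var X) by rewrite sqrtr_gt0.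
have -> : X = fun w => Num.sqrt (var X) * standardize X w + mean P X.
  by apply/funext => w; rewrite /standardize; field; rewrite gt_eqF.
by eexists; eexists; apply: has_gaussian_law_affine Sms.
Qed.

Lemma gaussian_rv_limit {I : Type} (F : set_system I) {FF : ProperFilter F}
    (Xs : I -> T -> R) X :
  (forall i, L2 (Xs i)) -> L2 X -> (forall i, gaussian_rv P (Xs i)) ->
  ip P (fun w => Xs i w - X w) (fun w => Xs i w - X w) @[i --> F] --> 0 ->
  gaussian_rv P X.
Proof.
move=> Xs2 X2 XsG cX.
have cm : mean P (Xs i) @[i --> F] --> mean P X.
  rewrite -ip1r (_ : (fun i => mean P (Xs i)) = fun i => ip P (Xs i) (fun=> 1)).
    exact: (cvg_ip_diag Xs2 X2 (fun=> sqint_cst P 1) (sqint_cst P 1) cX (ip_subrr _)).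
  by apply/funext => i; rewrite ip1r.
have cv : var (Xs i) @[i --> F] --> var X.
  rewrite /var; apply: cvgB; first exact: cvg_ip_diag.
  exact: (cvgM cm cm).
have ccov : ip P (Xs i) X - mean P (Xs i) * mean P X @[i --> F] --> var X.
  apply: cvgB; first exact: (cvg_ip_diag Xs2 X2 (fun=> X2) X2 cX (ip_subrr X)).
  by rewrite expr2; apply: cvgM => //; exact: cvg_cst.
(* A limit of zero variance cannot be standardized and is almost surely constant. Otherwise
   [var (Xs i)] is eventually positive, and standardization is legitimate near the limit. *)
have [v0|v0] := eqVneq (var X) 0.
  apply: (@gaussian_rv_ae_cst _ (mean P X)) => //.
  by rewrite -varE.
have {}v0 : 0 < var X by rewrite lt_def v0 var_ge0.
have vs0 : \forall i \near F, 0 < var (Xs i) by exact: cvgr_gt cv _ v0.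
apply: gaussian_rv_unstandardize => //.
(* Eventually all standardized approximants share one law; that of [i0] serves as the reference. *)
have /filter_ex[i0 vi0] := vs0.
have [m [s S0ms]] := gaussian_rv_standardize vi0 (XsG i0).
exists m, s => A mA; rewrite -S0ms//.
apply: (same_law_limit (Xs := fun i => standardize (Xs i)) (F := F)) => //.
- by move=> i; exact: sqint_standardize.
- exact: sqint_standardize.
- by have /sqintP[] := sqint_standardize (Xs2 i0).
(* Expanding the square, the squared distance between the standardizations is 2 minus twice the
   correlation of [Xs i] and [X], and this correlation tends to 1. *)
- have lim : 1 - 2 * ((Num.sqrt (var (Xs i)))^-1 * (Num.sqrt (var X))^-1
       * (ip P (Xs i) X - mean P (Xs i) * mean P X)) + 1 @[i --> F] --> (0 : R).
    rewrite [X in _ --> X](_ : _ = 1 - 2 * ((Num.sqrt (var X))^-1 * (Num.sqrt (var X))^-1 * var X) + 1); last first.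
      rewrite -invfM -expr2 sqr_sqrtr ?(ltW v0)// mulVf ?gt_eqF//; ring.
    apply: cvgD; last exact: cvg_cst.
    apply: cvgB; first exact: cvg_cst.
    apply: cvgM; first exact: cvg_cst.
    apply: cvgM => //; apply: cvgM; last exact: cvg_cst.
    apply: cvgV; first by rewrite gt_eqF// sqrtr_gt0.
    exact: (continuous_cvg _ (@sqrt_continuous R _) cv).
  apply: cvg_trans lim; apply: near_eq_cvg.
  apply: filterS vs0 => i vi; have Si := sqint_standardize (Xs2 i); have S := sqint_standardize X2.
  by rewrite (ip_sub Si S) (ip_standardize1 (Xs2 i) vi) (ip_standardize1 X2 v0) (ip_standardize (Xs2 i) X2).
- apply: filterS vs0 => i vi; apply: standard_gaussian_same_law;
    rewrite ?sqint_standardize ?mean_standardize ?ip_standardize1//; exact: gaussian_rv_standardize.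
Qed.

End gaussian.

(** * Mean-square convergence of combinations, means and covariances *)

Section mean_square_limit.
Context {R : realType} {d : measure_display} {T : measurableType d}.
Variable P : probability T R.
Implicit Types X Y : T -> R.

Local Notation L2 X := (X \in Lfun P 2%:E).

(** [covariance P X X] is the expectation of [(X - m) ^ 2] with [m] the real number [fine 'E_P[X]].
    Its finiteness puts [X - m] in L^2, and adding the constant back gives [X]. *)
Lemma sqint_covariance X (k : R) : measurable_fun setT X ->
  covariance P X X = k%:E -> L2 X.
Proof.
move=> mX; rewrite unlock; set m := fine _ => cX.
have XmE : (fun w => X w - m) = (X \- cst m) by [].
have Xm2 : L2 (fun w => X w - m).
  apply/sqintP; split; first by apply: measurable_funB => //; exact: measurable_cst.
  rewrite (_ : (fun w => (X w - m) ^+ 2) = (X \- cst m) * (X \- cst m))%R; first by rewrite cX ltry.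
  by apply/funext => w; rewrite expr2.
rewrite (_ : X = fun w => (X w - m) + m); last by apply/funext => w; rewrite subrK.
by apply: sqintD => //; exact: sqint_cst.
Qed.

Lemma covariance_ip X Y : L2 X -> L2 Y ->
  covariance P X Y = (ip P X Y - mean P X * mean P Y)%:E.
Proof.
move=> X2 Y2; have XY1 := intM X2 Y2.
rewrite covarianceE; [|exact: sqint_int|exact: sqint_int|exact: XY1].
by rewrite -(mean_finK (sqint_int X2)) -(mean_finK (sqint_int Y2)) -(mean_finK XY1).
Qed.

Definition ms_cvg {I : Type} (F : set_system I) (Xs : I -> T -> R) X :=
  [/\ forall i, L2 (Xs i), L2 X &
    ip P (fun w => Xs i w - X w) (fun w => Xs i w - X w) @[i --> F] --> 0].

(** Square integrability of the limit follows from a single index at which the expected squared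
    distance is finite, since [X = Xs i - (Xs i - X)]. *)
Lemma ms_cvg_expectation {I : Type} (F : set_system I) {FF : ProperFilter F}
    (Xs : I -> T -> R) X : (forall i, L2 (Xs i)) -> measurable_fun setT X ->
  'E_P[(fun w => (Xs i w - X w) ^+ 2)%R]%E @[i --> F] --> 0%E -> ms_cvg F Xs X.
Proof.
move=> Xs2 mX cX.
have mXs i : measurable_fun setT (Xs i) by have /sqintP[] := Xs2 i.
have ipE i : ip P (fun w => Xs i w - X w) (fun w => Xs i w - X w) =
    fine 'E_P[(fun w => (Xs i w - X w) ^+ 2)%R]%E.
  by rewrite /ip /mean; congr (fine 'E_P[_]%E); apply/funext => w; rewrite expr2.
have X2 : L2 X.
  have /filter_ex[i Ei] : \forall i \near F, ('E_P[(fun w => (Xs i w - X w) ^+ 2)%R] < 1)%E.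
    apply: (cX [set y | (y < 1)%E]); apply: open_nbhs_nbhs.
    by split; [exact: open_ereal_lt_ereal|exact: lte01].
  have D2 : L2 (fun w => Xs i w - X w).
    by apply/sqintP; split; [exact: measurable_funB|exact: lt_trans Ei (ltry _)].
  rewrite (_ : X = fun w => Xs i w - (Xs i w - X w)); first exact: sqintB.
  by apply/funext => w; rewrite subKr.
split=> //; under eq_fun do rewrite ipE; exact: fine_cvg.
Qed.

Lemma ms_cvg0 {I : Type} (F : set_system I) {FF : Filter F} :
  ms_cvg F (fun _ _ => 0) (fun=> 0).
Proof. by split=> [_||]; [exact: sqint_cst|exact: sqint_cst|exact: (ip_subrr P (fun=> 0))]. Qed.

Lemma ms_cvgZ {I : Type} (F : set_system I) {FF : Filter F} (a : R)
    (Xs : I -> T -> R) X :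
  ms_cvg F Xs X -> ms_cvg F (fun i w => a * Xs i w) (fun w => a * X w).
Proof.
move=> [Xs2 X2 cX]; split=> [i||]; [exact: sqintZ|exact: sqintZ|].
rewrite (_ : (fun i => _) = fun i => a ^+ 2 * ip P (fun w => Xs i w - X w) (fun w => Xs i w - X w)).
  rewrite -[X in _ --> X](mulr0 (a ^+ 2)); apply: cvgM => //; exact: cvg_cst.
apply/funext => i; have D2 := sqintB (Xs2 i) X2.
rewrite /ip -meanZ; last exact: intM.
by congr mean; apply/funext => w; ring.
Qed.

Lemma ms_cvgD {I : Type} (F : set_system I) {FF : Filter F}
    (Xs Ys : I -> T -> R) X Y : ms_cvg F Xs X -> ms_cvg F Ys Y ->
  ms_cvg F (fun i w => Xs i w + Ys i w) (fun w => X w + Y w).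
Proof.
move=> [Xs2 X2 cX] [Ys2 Y2 cY]; split=> [i||]; [exact: sqintD|exact: sqintD|].
pose qX i := ip P (fun w => Xs i w - X w) (fun w => Xs i w - X w).
pose qY i := ip P (fun w => Ys i w - Y w) (fun w => Ys i w - Y w).
apply: (@squeeze_cvgr _ _ _ _ (fun=> 0) (fun i => 2 * (qX i + qY i))).
- apply: nearW => i; rewrite ip_ge0 /=.
  have A2 := sqintB (Xs2 i) X2; have B2 := sqintB (Ys2 i) Y2.
  pose A w := Xs i w - X w; pose B w := Ys i w - Y w.
  rewrite (_ : (fun w => _) = fun w => A w + B w); last first.
    by apply/funext => w; rewrite /A /B; ring.
  (* Nonnegativity of the squared norm of [A - B] bounds that of [A + B] by twice the sum of the
     squared norms of [A] and [B]. *)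
  have := ip_ge0 P (fun w => A w - B w).
  rewrite (ip_sub A2 B2) (ipDl A2 B2 (sqintD A2 B2)) (ipDr A2 B2 A2) (ipDr A2 B2 B2) (ipC P B A).
  rewrite -/(ip P A A) /qX /qY -/A -/B; lra.
- exact: cvg_cst.
- rewrite [X in _ --> X](_ : _ = 2 * (0 + 0)); last by rewrite addr0 mulr0.
  by apply: cvgM; [exact: cvg_cst|exact: cvgD].
Qed.

Lemma ms_cvg_sum {I : Type} (F : set_system I) {FF : Filter F} (J : Type) (r : seq J)
    (Xs : J -> I -> T -> R) (X : J -> T -> R) :
  (forall j, ms_cvg F (Xs j) (X j)) ->
  ms_cvg F (fun i w => \sum_(j <- r) Xs j i w) (fun w => \sum_(j <- r) X j w).
Proof.
move=> cX; elim: r => [|j r IHr].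
  rewrite (_ : (fun i w => _) = fun _ _ => 0); last by do 2 apply/funext => ?; rewrite big_nil.
  by rewrite (_ : (fun w => _) = fun=> 0);
    [exact: ms_cvg0|apply/funext => ?; rewrite big_nil].
rewrite (_ : (fun i w => _) = fun i w => Xs j i w + \sum_(j <- r) Xs j i w); last first.
  by do 2 apply/funext => ?; rewrite big_cons.
rewrite (_ : (fun w => _) = fun w => X j w + \sum_(j <- r) X j w); last first.
  by apply/funext => ?; rewrite big_cons.
exact: ms_cvgD.
Qed.

Lemma ms_cvg_mean {I : Type} (F : set_system I) {FF : Filter F} (Xs : I -> T -> R) X :
  ms_cvg F Xs X -> mean P (Xs i) @[i --> F] --> mean P X.
Proof.
move=> [Xs2 X2 cX]; rewrite -ip1r (_ : (fun i => mean P (Xs i)) = fun i => ip P (Xs i) (fun=> 1)).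
  exact: (cvg_ip_diag Xs2 X2 (fun=> sqint_cst P 1) (sqint_cst P 1) cX (ip_subrr P _)).
by apply/funext => i; rewrite ip1r.
Qed.

Lemma ms_cvg_cov {I J : Type} (F : set_system I) (G : set_system J)
    {FF : Filter F} {FG : Filter G} (Xs : I -> T -> R) X (Ys : J -> T -> R) Y :
  ms_cvg F Xs X -> ms_cvg G Ys Y ->
  ip P (Xs ij.1) (Ys ij.2) - mean P (Xs ij.1) * mean P (Ys ij.2)
    @[ij --> filter_prod F G] --> ip P X Y - mean P X * mean P Y.
Proof.
move=> cX cY; have mX : mean P (Xs i) @[i --> F] --> mean P X by exact: ms_cvg_mean.
have mY : mean P (Ys j) @[j --> G] --> mean P Y by exact: ms_cvg_mean.
case: cX cY => Xs2 X2 cX [Ys2 Y2 cY].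
have mX' : (fun ij : I * J => mean P (Xs ij.1)) @ filter_prod F G --> mean P X.
  exact: (cvg_comp fst (fun i => mean P (Xs i)) cvg_fst mX).
have mY' : (fun ij : I * J => mean P (Ys ij.2)) @ filter_prod F G --> mean P Y.
  exact: (cvg_comp snd (fun j => mean P (Ys j)) cvg_snd mY).
by apply: cvgB; [exact: cvg_ip|exact: cvgM mX' mY'].
Qed.

End mean_square_limit.

(** * Riesz representation, changes of chart and the gradient *)

(** Positivity makes the Gram matrix [G] of the standard basis invertible, since a kernel vector [u]
    has [b u u = 0]. The representing vector is the row of values of [L] on the basis times
    [invmx G]. *)
Lemma riesz_rV (R : realFieldType) (n : nat) (b : 'rV[R]_n -> 'rV[R]_n -> R)
    (L : {linear 'rV[R]_n -> R}) :
  (forall a u v w, b (a *: u + v) w = a * b u w + b v w) ->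
  (forall u v, b u v = b v u) -> (forall u, u != 0 -> 0 < b u u) ->
  exists w, forall u, b w u = L u.
Proof.
move=> bl bs bp.
have b0 v : b 0 v = 0 by rewrite -[0](subrr (0 : 'rV_n)) -scaleN1r addrC bl mulN1r addNr.
have bsum u v : b u v = \sum_(i < n) u 0 i * b (delta_mx 0 i) v.
  rewrite {1}(row_sum_delta u) (big_morph (b^~ v) (id1 := 0) (op1 := +%R)) //.
    by apply: eq_bigr => i _; rewrite -[_ *: _]addr0 bl b0 addr0.
  by move=> x y; rewrite -[x]scale1r bl mul1r scale1r.
pose G : 'M[R]_n := \matrix_(i, j) b (delta_mx 0 i) (delta_mx 0 j).
have uG u j : (u *m G) 0 j = b u (delta_mx 0 j).
  by rewrite bsum mxE; apply: eq_bigr => i _; rewrite mxE.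
have Gu : G \in unitmx.
  rewrite -row_free_unit; apply: inj_row_free => u uG0; apply/eqP/negPn/negP => /bp.
  rewrite {1}bsum big1 ?ltxx// => i _.
  by rewrite bs -uG uG0 mxE mulr0.
exists ((\row_j L (delta_mx 0 j)) *m invmx G) => u.
rewrite bs bsum [in RHS](row_sum_delta u) linear_sum; apply: eq_bigr => i _.
by rewrite bs -uG mulmxKV// mxE linearZ.
Qed.

Lemma diff_near_eq (R : numFieldType) (V W : normedModType R) (f g : V -> W) (a : V) :
  differentiable f a -> differentiable g a -> (\near a, f a = g a) ->
  forall v, 'd f a v = 'd g a v.
Proof. by move=> df dg fg v; rewrite -!deriveE//; exact: near_eq_derive. Qed.

Section geometry.
Variables (R : realType) (n : nat) (M : smoothManifold R n).
Local Notation tvec := (tvec M).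
Implicit Types (i j k : chart M) (x : M).

Let transition i j := chart_coord j \o chart_param i.

Lemma transition_differentiable i j x : chart_dom i x -> chart_dom j x ->
  differentiable (transition i j) (chart_coord i x).
Proof. by move=> xi xj; apply: (transition_smooth i j 1).1; exists x. Qed.

Lemma near_chart_dom i j x : chart_dom i x -> chart_dom j x ->
  \forall y \near chart_coord i x, chart_dom j (chart_param i y).
Proof.
move=> xi xj; have U : (chart_coord i @` chart_dom i) (chart_coord i x) by exists x.
apply: (param_continuous U); rewrite coordK//.
by apply: open_nbhs_nbhs; split => //; exact: dom_open.
Qed.

Lemma near_coord_paramK i x : chart_dom i x ->
  \forall y \near chart_coord i x, chart_coord i (chart_param i y) = y.
Proof.
move=> xi; have : nbhs (chart_coord i x) (chart_coord i @` chart_dom i).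
  by apply: open_nbhs_nbhs; split; [exact: img_open|exists x].
by apply: filterS => _ [z zi <-]; rewrite coordK.
Qed.

Lemma diff_transition_id i x u : chart_dom i x ->
  'd (transition i i) (chart_coord i x) u = u.
Proof.
move=> xi; transitivity ('d (id : 'rV[R]_n -> 'rV[R]_n) (chart_coord i x) u); last by rewrite diff_val.
apply: diff_near_eq; [exact: transition_differentiable|exact: ex_diff|exact: near_coord_paramK].
Qed.

(** The chain rule for [f \o chart_param i = (f \o chart_param j) \o transition i j], an identity
    used only near [chart_coord i x], where [chart_param i] takes values in the domain of [j]. *)
Lemma diff_chart_change (W : normedModType R) (f : M -> W) i j x u :
  chart_dom i x -> chart_dom j x ->
  differentiable (f \o chart_param i) (chart_coord i x) ->
  differentiable (f \o chart_param j) (chart_coord j x) ->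
  'd (f \o chart_param i) (chart_coord i x) u =
  'd (f \o chart_param j) (chart_coord j x) ('d (transition i j) (chart_coord i x) u).
Proof.
move=> xi xj dfi dfj.
have tij := transition_differentiable xi xj.
have tE : transition i j (chart_coord i x) = chart_coord j x by rewrite /transition /= coordK.
have dc : differentiable (f \o chart_param j) (transition i j (chart_coord i x)) by rewrite tE.
have cE := diff_comp tij dc.
transitivity ('d ((f \o chart_param j) \o transition i j) (chart_coord i x) u).
  apply: diff_near_eq dfi (differentiable_comp tij dc) _ u.
  by apply: filterS (near_chart_dom xi xj) => y yj; rewrite /= coordK.
rewrite -tE; exact: (congr1 (fun h => h u) cE).
Qed.

Lemma tangent_tvec_of i x u : chart_dom i x -> tangent x (tvec_of i x u).
Proof.
move=> xi; split=> [j xj|j k xj xk]; rewrite /tvec_of.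
  by case: asboolP.
do 2 (case: asboolP => // _).
exact: (diff_chart_change u xi xj (transition_differentiable xi xk) (transition_differentiable xj xk)).
Qed.

Lemma tvec_ofE i x u : chart_dom i x -> tvec_of i x u i = u.
Proof. by move=> xi; rewrite /tvec_of; case: asboolP => // _; exact: diff_transition_id. Qed.

Lemma tangentE i x (v : tvec) : chart_dom i x -> tangent x v -> v = tvec_of i x (v i).
Proof.
move=> xi [v0 vt]; apply/funext => j; rewrite /tvec_of.
by case: asboolP => xj; [exact: vt|exact: v0].
Qed.

Lemma tvec_of_linear i x (a : R) u v :
  tvec_of i x (a *: u + v) = a *: tvec_of i x u + tvec_of i x v :> tvec.
Proof.
apply/funext => j; rewrite /tvec_of.
change ((if `[< chart_dom j x >] then 'd (transition i j) (chart_coord i x) (a *: u + v) else 0) =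
  a *: (if `[< chart_dom j x >] then 'd (transition i j) (chart_coord i x) u else 0) +
  (if `[< chart_dom j x >] then 'd (transition i j) (chart_coord i x) v else 0)).
by case: ifP => _; [rewrite linearP|rewrite scaler0 addr0].
Qed.

Variable g : riemannianMetric M.

(** As [gradient] is defined by [get], a representing vector must be exhibited. The chart [i]
    transports the metric to row vectors, where [riesz_rV] applies; [diff_chart_change] then gives
    the defining property in every chart around [x]. *)
Lemma gradientE (f : M -> R) i x (v : tvec) : mdifferentiable f ->
  chart_dom i x -> tangent x v ->
  inner g x (gradient g f x) v = 'd (f \o chart_param i) (chart_coord i x) (v i).
Proof.
move=> df xi xv; rewrite /gradient.
set A := [set w | _].
suff Aex : A !=set0 by have [_ Ag] := getPex Aex; exact: Ag.
have xW u := tangent_tvec_of u xi.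
have [|||w wE] := @riesz_rV R n (fun u v => inner g x (tvec_of i x u) (tvec_of i x v))
  ('d (f \o chart_param i) (chart_coord i x)).
- by move=> a u1 u2 w; rewrite tvec_of_linear inner_linear.
- by move=> u1 u2; rewrite inner_sym.
- move=> u u0; apply: inner_pos => // W0; move/eqP: u0; apply.
  by rewrite -(tvec_ofE u xi) W0.
exists (tvec_of i x w); split=> // u xu j xj.
have [_ /(_ i j xi xj) ->] := xu.
rewrite -(diff_chart_change (u i) xi xj (df _ _ xi) (df _ _ xj)) -wE.
by congr inner; exact: tangentE.
Qed.

(** By continuity the curve stays in the chart near time 0, where [f \o c] equals [h], a composite
    of maps between normed spaces, and the chain rule applies. *)
Lemma derive_along_curve (f : M -> R) i (c : R -> M) :
  mdifferentiable f -> chart_dom i (c 0) -> {for 0, continuous c} ->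
  derivable (chart_coord i \o c) 0 1 ->
  (f (c t) - f (c 0)) / t @[t --> (0:R)^'] -->
    'd (f \o chart_param i) (chart_coord i (c 0)) (derive1 (chart_coord i \o c) 0).
Proof.
move=> df xi cc /[dup] du /derivable1_diffP du'.
pose h := (f \o chart_param i) \o (chart_coord i \o c).
have dh' : differentiable h 0 by apply: differentiable_comp => //; exact: df.
have dh : derivable h 0 1 by exact: diff_derivable.
have nc : nbhs (c 0) (chart_dom i) by apply: open_nbhs_nbhs; split => //; exact: dom_open.
have cdom : \forall t \near (0 : R), chart_dom i (c t) := cc _ nc.
have hE : \forall t \near (0 : R), h t = f (c t).
  by apply: filterS cdom => t ci; rewrite /h /= coordK.
have dfi : differentiable (f \o chart_param i) ((chart_coord i \o c) 0) := df i (c 0) xi.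
have hD : 'D_1 h 0 = 'd (f \o chart_param i) (chart_coord i (c 0)) (derive1 (chart_coord i \o c) 0).
  rewrite deriveE; last exact: dh'.
  rewrite derive1E'; last exact: du'.
  exact: (congr1 (fun F => F 1) (diff_comp du' dfi)).
rewrite -hD; apply: cvg_trans dh; apply: near_eq_cvg; apply: nbhs_dnbhs.
apply: filterS hE => t ht /=; rewrite addr0 [t *: 1]mulr1 ht.
have -> : h 0 = f (c 0) by rewrite /h /= coordK.
by rewrite mulrC.
Qed.

End geometry.

(** * Moments of difference quotients *)

Section difference_quotients.
Context {R : realType} {d : measure_display} {T : measurableType d}.
Variable P : probability T R.
Implicit Types A B C D : T -> R.

Local Notation L2 X := (X \in Lfun P 2%:E).

Lemma sqint_quotient A B (t : R) : L2 A -> L2 B -> L2 (fun w => (A w - B w) / t).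
Proof.
move=> A2 B2; rewrite (_ : (fun w => _) = fun w => t^-1 * (A w - B w)).
  by apply: sqintZ; exact: sqintB.
by apply/funext => w; rewrite mulrC.
Qed.

Lemma mean_quotient A B (t : R) : L2 A -> L2 B ->
  mean P (fun w => (A w - B w) / t) = (mean P A - mean P B) / t.
Proof.
move=> A2 B2; have AB2 := sqintB A2 B2.
rewrite (_ : (fun w => _) = fun w => t^-1 * (A w - B w)); last first.
  by apply/funext => w; rewrite mulrC.
rewrite (meanZ _ (sqint_int AB2)) mulrC; congr (_ / _).
by rewrite -!ip1r; apply: ipBl => //; exact: sqint_cst.
Qed.

(** Bilinearity of the covariance, arranged in the shape of [mixed_quotient]. With [0^-1 = 0] it
    also holds for [t = 0] or [s = 0], so it gives an equality of functions of [(t, s)]. *)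
Lemma cov_quotient A B C D (t s : R) : L2 A -> L2 B -> L2 C -> L2 D ->
  ip P (fun w => (A w - B w) / t) (fun w => (C w - D w) / s)
    - mean P (fun w => (A w - B w) / t) * mean P (fun w => (C w - D w) / s) =
  (t * s)^-1 * ((ip P A C - mean P A * mean P C) - (ip P B C - mean P B * mean P C)
    - (ip P A D - mean P A * mean P D) + (ip P B D - mean P B * mean P D)).
Proof.
move=> A2 B2 C2 D2; rewrite !mean_quotient//.
have AB2 := sqintB A2 B2; have CD2 := sqintB C2 D2.
rewrite (_ : (fun w => (A w - B w) / t) = fun w => t^-1 * (A w - B w)); last first.
  by apply/funext => w; rewrite mulrC.
rewrite (_ : (fun w => (C w - D w) / s) = fun w => s^-1 * (C w - D w)); last first.
  by apply/funext => w; rewrite mulrC.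
rewrite (ipZl _ AB2 (sqintZ _ CD2)) (ipZr _ CD2 AB2) (ipBl A2 B2 CD2).
rewrite (ipBr C2 D2 A2) (ipBr C2 D2 B2) invfM.
by ring.
Qed.

End difference_quotients.

Theorem lemma3p5 (R : realType) (n : nat)
    (M : smoothManifold R n) (g : riemannianMetric M)
    (M_compact : compact [set: M])
    (expM : M -> tvec M -> M)
    (expM_exp : is_exponential g expM)
    (d : measure_display) (T : measurableType d) (P : probability T R)
    (Z : M -> {RV P >-> R}) (mu : M -> R) (K : M -> M -> R)
    (Z_gp : gaussian_process Z mu K)
    (Z_msd : msd1 g Z)
    (mu_diff : mdifferentiable mu)
    (V : M -> tvec M) (V_smooth : smooth_vector_field V)
    (DVZ : M -> {RV P >-> R})
    (DVZ_deriv : is_derivative_process expM V Z DVZ) :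
  (forall x x', mixed_derivable expM K x (V x) x' (V x')) /\
  gaussian_process DVZ
    (fun x => inner g x (gradient g mu x) (V x))
    (fun x x' => mixed_derive expM K x (V x) x' (V x')).
Proof.
have [Vt _] := V_smooth; have [Zfdd Zmean Zcov] := Z_gp.
have Z2 y : (Z y : T -> R) \in Lfun P 2%:E.
  by apply: (sqint_covariance _ (Zcov y y)); exact: measurable_funP.
have muE y : mean P (Z y) = mu y by rewrite /mean Zmean.
have KE x y : K x y = ip P (Z x) (Z y) - mean P (Z x) * mean P (Z y).
  by have := Zcov x y; rewrite covariance_ip// => -[->].
pose Q x (t : R) : T -> R := fun w => (Z (expM x (t *: V x)) w - Z x w) / t.
have Q2 x t : Q x t \in Lfun P 2%:E by exact: sqint_quotient.
have cQ x : ms_cvg P (0 : R)^' (Q x) (DVZ x).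
  by apply: ms_cvg_expectation; [exact: Q2|exact: measurable_funP|exact: DVZ_deriv].
have D2 x : (DVZ x : T -> R) \in Lfun P 2%:E by have [] := cQ x.
have mixedE x x' : mixed_quotient expM K x (V x) x' (V x') =
    fun ts => ip P (Q x ts.1) (Q x' ts.2) - mean P (Q x ts.1) * mean P (Q x' ts.2).
  by apply/funext => ts; rewrite /mixed_quotient cov_quotient// !KE.
(* One limit serves twice: it proves that the mixed derivative exists and identifies it with the
   covariance of the derivative process. *)
have mixed_cvg x x' : mixed_quotient expM K x (V x) x' (V x') ts
    @[ts --> filter_prod (0:R)^' (0:R)^'] -->
    ip P (DVZ x) (DVZ x') - mean P (DVZ x) * mean P (DVZ x').
  by rewrite mixedE; exact: ms_cvg_cov.
split; first by move=> x x'; apply/cvg_ex; eexists; exact: mixed_cvg.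
split=> [k x a|x|x x'].
- have cS := ms_cvg_sum (index_enum 'I_k) (fun j => ms_cvgZ (a j) (cQ (x j))).
  have [S2 L2S cS'] := cS _ _.
  apply: (gaussian_rv_limit S2 L2S _ cS') => t.
  (* A combination of k quotients is a combination of 2k values of Z. *)
  pose y (j : 'I_(k + k)) := match fintype.split j with
    inl j => expM (x j) (t *: V (x j)) | inr j => x j end.
  (* For [t = 0] all coefficients are 0, in agreement with the quotients, so every [t] is
     covered. *)
  pose b (j : 'I_(k + k)) := match fintype.split j with
    inl j => a j / t | inr j => - (a j / t) end.
  have := Zfdd _ y b; congr (gaussian_rv P _); apply/funext => w.
  rewrite big_split_ord /= -big_split /=; apply: eq_bigr => j _.
  rewrite /b /y -[lshift _ _]/(unsplit (inl j)) -[rshift _ _]/(unsplit (inr j)) !unsplitK /Q; ring.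
- rewrite -(mean_finK (sqint_int (D2 x))); congr EFin.
  have [i xi] := dom_cover x.
  have [[_ _ cc cd] c0 cv] := expM_exp x (V x) (Vt x).
  pose c t := expM x (t *: V x).
  have ci : chart_dom i (c 0) by rewrite /c c0.
  have [du _ _] := cd 0 i I ci.
  have lim := derive_along_curve mu_diff ci (cc 0 I) du.
  (* The means of the quotients tend both to the mean of [DVZ x] and, along the geodesic [c], to the
     differential of [mu] at [x] applied to [V x]; uniqueness of limits equates the two. *)
  have mQ : (fun t => mean P (Q x t)) = fun t => (mu (c t) - mu (c 0)) / t.
    by apply/funext => t; rewrite mean_quotient// !muE {2}/c c0.
  have cm : mean P (Q x t) @[t --> (0 : R)^'] --> mean P (DVZ x) by exact: ms_cvg_mean.
  rewrite mQ in cm; have -> := cvg_unique (@norm_hausdorff _ _) cm lim.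
  rewrite (gradientE g mu_diff xi (Vt x)) -cv /velocity /c c0.
  by case: asboolP.
- rewrite (covariance_ip (D2 x) (D2 x')); congr EFin; apply/esym/cvg_lim => //; exact: mixed_cvg.
Qed.
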